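(* Let $p$ be an odd prime, let $G=H_3$ or $G=E_3$, and let $B$ be a Rota--Baxter operator on $G$. Then there exist parameters $l_\alpha,l_\beta,m_\alpha,m_\beta,x_\alpha,x_\beta,k$, in $\mathbb{Z}_p$ if $G=H_3$ and in $\mathbb{Z}_{p^2}$ if $G=E_3$, such that for all $0\le t,s,r\le p-1$ $$B(b^sa^tc^r)=b^{B_\beta(t,s)}a^{B_\alpha(t,s)}c^{B_\gamma(t,s,r)},$$ where $$B_\alpha(t,s)=l_\alpha t+l_\beta s,\qquad B_\beta(t,s)=m_\alpha t+m_\beta s,$$ $$B_\gamma(t,s,r)=x_\alpha t+x_\beta s+(l_\beta m_\alpha+km_\beta)ts+m_\alpha(l_\alpha+k)\frac{t(t-1)}{2}+l_\beta(m_\beta-k)\frac{s(s-1)}{2}+kr,$$ and the following equalities hold: \begin{itemize} \item $l_\alpha m_\beta-kl_\alpha=l_\beta m_\alpha+km_\beta+k \pmod p$, if $G=H_3$; \item $k=l_\alpha+m_\alpha=l_\beta+m_\beta \pmod p$ and $k\in\{0,-1\}\pmod p$, if $G=E_3$. \end{itemize}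
   Context: Convention: $[g,h]=g^{-1}h^{-1}gh$. $H_3=\langle a,b,c\mid [a,b]=c,\ [a,c]=[b,c]=a^p=b^p=c^p=e\rangle$ and $E_3=\langle a,b,c\mid [a,b]=c,\ a^p=b^p=c,\ [a,c]=[b,c]=c^p=e\rangle$ are groups of order $p^3$; in each, every element is uniquely $b^sa^tc^r$ with $0\le s,t,r\le p-1$. In $E_3$ the elements $a,b$ have order $p^2$, so exponents of $a,b$ are taken in $\mathbb{Z}_{p^2}$, while exponents of $c$ only matter modulo $p$. A Rota--Baxter operator on a group $G$ is a map $B\colon G\to G$ such that $B(g)B(h)=B\big(gB(g)hB(g)^{-1}\big)$ for all $g,h\in G$. *)

(* Defs.v *)
From mathcomp Require Import all_boot all_order all_algebra all_fingroup.
Set Implicit Arguments.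
Unset Strict Implicit.
Unset Printing Implicit Defensive.

Import GroupScope.

Definition rota_baxter (gT : finGroupType) (B : gT -> gT) : Prop :=
  forall g h : gT, B g * B h = B (g * B g * h * (B g)^-1).

(* The whole type gT is the presented group, with a, b, c as the generators of
   the presentation.  The predicate [\isog Grp] only describes gT up to
   isomorphism, so the triple is pinned down by also requiring that it generates
   gT and satisfies the relations: since gT is finite, such a triple is the image
   of the tautological one under an isomorphism from the presented group.
   The library commutator [~ x, y] is x^-1 * y^-1 * x * y. *)
Definition is_H3 (p : nat) (gT : finGroupType) (a b c : gT) : Prop :=
  [/\ [set: gT] \isog Grp (x : y : z :
        [~ x, y] = z, [~ x, z] = 1, [~ y, z] = 1,
        x ^+ p = 1, y ^+ p = 1, z ^+ p = 1),
      <<[set a; b; c]>> = [set: gT],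
      [/\ [~ a, b] = c, [~ a, c] = 1 & [~ b, c] = 1] &
      [/\ a ^+ p = 1, b ^+ p = 1 & c ^+ p = 1]].

Definition is_E3 (p : nat) (gT : finGroupType) (a b c : gT) : Prop :=
  [/\ [set: gT] \isog Grp (x : y : z :
        [~ x, y] = z, x ^+ p = z, y ^+ p = z,
        [~ x, z] = 1, [~ y, z] = 1, z ^+ p = 1),
      <<[set a; b; c]>> = [set: gT],
      [/\ [~ a, b] = c, [~ a, c] = 1 & [~ b, c] = 1] &
      [/\ a ^+ p = c, b ^+ p = c & c ^+ p = 1]].

(* Below m is the modulus of the parameters: p for H_3 and p ^ 2 for E_3. *)

Definition B_alpha (m : nat) (la lb : 'Z_m) (t s : nat) : 'Z_m :=
  (la * t%:R + lb * s%:R)%R.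

Definition B_beta (m : nat) (ma mb : 'Z_m) (t s : nat) : 'Z_m :=
  (ma * t%:R + mb * s%:R)%R.

Definition B_gamma (m : nat) (la lb ma mb xa xb k : 'Z_m) (t s r : nat) :
    'Z_m :=
  (xa * t%:R + xb * s%:R + (lb * ma + k * mb) * (t * s)%:R
   + ma * (la + k) * ((t * (t - 1)) %/ 2)%:R
   + lb * (mb - k) * ((s * (s - 1)) %/ 2)%:R
   + k * r%:R)%R.

(* A residue in 'Z_m used as an exponent stands for its representative in
   [0, m); for m = p or p ^ 2 respectively, x ^+ m = 1 for x = a, b, c. *)
Definition has_B_form (m p : nat) (gT : finGroupType) (a b c : gT)
    (B : gT -> gT) (la lb ma mb xa xb k : 'Z_m) : Prop :=
  forall t s r : nat, (t < p)%N -> (s < p)%N -> (r < p)%N ->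
    B (b ^+ s * a ^+ t * c ^+ r) =
      b ^+ B_beta ma mb t s * a ^+ B_alpha la lb t s
      * c ^+ B_gamma la lb ma mb xa xb k t s r.

Definition eq_modp (p : nat) (u v : 'Z_(p ^ 2)) : Prop :=
  (u : nat) = (v : nat) %[mod p].

(* Main.v *)
Require Import Defs.
From mathcomp Require Import all_boot all_order all_algebra all_fingroup.
From mathcomp Require Import all_solvable ring.
Set Implicit Arguments.
Unset Strict Implicit.
Unset Printing Implicit Defensive.
Import GroupScope.
Import GRing.Theory.

(** Since [c] is central, [B (g * c) = B g * B c], and hence [B c] is central,
so [B c = c ^+ k].  As commutators are powers of [c], the Rota-Baxter identity
becomes [B g * B h = B (g * h) * c ^+ (k * w)], where [w] is the exponent of [c]
in the commutator of [B g] and [h]: [B] is a homomorphism up to an explicit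
central factor.  It is thus determined by [B a], [B b] and [k], and induction on
the exponents gives the formula for [B (b ^+ s * a ^+ t * c ^+ r)].  Comparing
[B (a * b)] with [B (b * a)] gives the relation between the parameters; in
[E_3], the values of [B (a ^+ p)] and [B (b ^+ p)] give two more, and the three
together force [k * (k + 1) = 0] modulo [p]. *)

(** * Exponents taken in ['Z_m] *)

Section ZmodExponents.

Variables (gT : finGroupType) (m : nat) (x : gT).
Hypotheses (m_gt1 : 1 < m) (xm : x ^+ m = 1).

Lemma expg_ZpD (u v : 'Z_m) : x ^+ (u + v)%R = x ^+ u * x ^+ v.
Proof.
(* Arithmetic in ['Z_m] is modulo [(Zp_trunc m).+2], which equals [m] because [1 < m]. *)
have xT : x ^+ (Zp_trunc m).+2 = 1 by rewrite Zp_cast.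
by rewrite -expgD /= expg_mod.
Qed.

Lemma expg_ZpM (u v : 'Z_m) : x ^+ (u * v)%R = x ^+ (u * v)%N.
Proof.
have xT : x ^+ (Zp_trunc m).+2 = 1 by rewrite Zp_cast.
by rewrite /= expg_mod.
Qed.

Lemma expg_Zp_nat (n : nat) : x ^+ (n%:R : 'Z_m)%R = x ^+ n.
Proof. by rewrite val_Zp_nat // expg_mod. Qed.

Lemma expg_Zp_mulrn (u : 'Z_m) (n : nat) : x ^+ (u * n%:R)%R = (x ^+ n) ^+ u.
Proof. by rewrite expg_ZpM // mulnC expgM expg_Zp_nat. Qed.

End ZmodExponents.

(** * Normal forms, for both groups at once: [m] is [p] for $H_3$ and [p ^ 2] for $E_3$ *)

Section CentralExtension.

Variables (gT : finGroupType) (m p : nat) (a b c : gT).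
Hypotheses (p_prime : prime p) (m_gt1 : 1 < m).
Hypotheses (gen_abc : <<[set a; b; c]>> = [set: gT]) (comm_ab : [~ a, b] = c).
Hypotheses (cac : commute a c) (cbc : commute b c).
Hypotheses (am : a ^+ m = 1) (bm : b ^+ m = 1) (cm : c ^+ m = 1).
Hypotheses (ap : a ^+ p \in <[c]>) (bp : b ^+ p \in <[c]>) (oc : #[c] = p).

Definition nform (u v w : 'Z_m) : gT := b ^+ u * a ^+ v * c ^+ w.

Lemma nform_nat (s t r : nat) :
  nform s%:R%R t%:R%R r%:R%R = b ^+ s * a ^+ t * c ^+ r.
Proof. by rewrite /nform !expg_Zp_nat. Qed.

(** Moving [a ^+ v] to the right past [b ^+ u'] costs the central factor [c ^+ (v * u')]. *)
Lemma nform_mul (u v w u' v' w' : 'Z_m) :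
  nform u v w * nform u' v' w' = nform (u + u')%R (v + v')%R (w + w' + v * u')%R.
Proof.
have swap (i j : nat) : a ^+ i * b ^+ j = b ^+ j * a ^+ i * c ^+ (i * j).
  by rewrite commgC commXXg comm_ab //.
have cX (n i j : nat) : commute (c ^+ n) (b ^+ i * a ^+ j).
  by apply: commuteM; apply: commuteX2; apply: commute_sym.
have ca (i j : nat) : commute (c ^+ i) (a ^+ j).
  exact/commuteX2/commute_sym.
rewrite /nform !expg_ZpD // expg_ZpM // [LHS]mulgA -[_ * c ^+ w * _]mulgA cX.
rewrite !mulgA -[_ * a ^+ v * b ^+ u']mulgA swap !mulgA.
rewrite -[_ * c ^+ (v * u') * a ^+ v']mulgA ca !mulgA -!mulgA -!expgD.
by rewrite addnC -addnA (addnC w').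
Qed.

Lemma nform_a : a = nform 0%R 1%R 0%R.
Proof. by have := nform_nat 0 1 0; rewrite mul1g mulg1 expg1 => <-. Qed.

Lemma nform_b : b = nform 1%R 0%R 0%R.
Proof. by have := nform_nat 1 0 0; rewrite !mulg1 expg1 => <-. Qed.

Lemma nform_c (z : 'Z_m) : c ^+ z = nform 0%R 0%R z.
Proof. by rewrite /nform !mul1g. Qed.

Lemma nform_mulc (u v w z : 'Z_m) : nform u v w * c ^+ z = nform u v (w + z)%R.
Proof. by rewrite nform_c nform_mul; congr nform; ring. Qed.

Lemma nform_swap (u v w s t r : 'Z_m) :
  nform u v w * nform s t r
    = nform s t r * nform u v w * c ^+ (v * s - u * t)%R.
Proof. by rewrite !nform_mul nform_mulc; congr nform; ring. Qed.

(** In a finite group, a set containing 1 and closed under products is a subgroup, so [nform_mul]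
    suffices. Uniqueness is not claimed: it fails in $E_3$, where [a ^+ p = c]. *)
Lemma nform_surj (g : gT) : exists u v w, g = nform u v w.
Proof.
pose A := [set nform x.1.1 x.1.2 x.2 | x : 'Z_m * 'Z_m * 'Z_m].
have A_nform u v w : nform u v w \in A by apply/imsetP; exists (u, v, w).
have gA : group_set A.
  apply/group_setP; split.
    by have -> : 1 = nform 0%R 0%R 0%R by rewrite -nform_c.
  by move=> _ _ /imsetP[x _ ->] /imsetP[y _ ->]; rewrite nform_mul.
have : g \in <<[set a; b; c]>> by rewrite gen_abc inE.
have sub : <<[set a; b; c]>> \subset group gA.
  rewrite gen_subG; apply/subsetP=> x; rewrite !inE -orbA.
  case/or3P=> /eqP->; rewrite ?[a]nform_a ?[b]nform_b //.
  by rewrite -[c]expg1 -(expg_Zp_nat m_gt1 cm) nform_c.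
by move/(subsetP sub)/imsetP=> [[[u v] w] _ ->]; exists u, v, w.
Qed.

(** This evaluates the formulas for [B (a ^+ p)] and [B (b ^+ p)] in $E_3$; the term in [z] vanishes
    because an odd [p] divides ['C(p, 2)]. *)
Lemma nform_mulp (u v w z : 'Z_m) :
    prime p -> odd p -> a ^+ p = c -> b ^+ p = c -> c ^+ p = 1 ->
  nform (u * p%:R)%R (v * p%:R)%R (w * p%:R + z * 'C(p, 2)%:R)%R = c ^+ (u + v)%R.
Proof.
move=> p_pr p_odd ap_c bp_c cp1; rewrite /nform !expg_ZpD // !expg_Zp_mulrn //.
have p_gt2 : 2 < p by apply: odd_prime_gt2.
have /dvdnP[q ->] : p %| 'C(p, 2) by apply: prime_dvd_bin.
by rewrite ap_c bp_c mulnC expgM cp1 !expg1n !mulg1.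
Qed.

Lemma commg_cycle (g h : gT) : [~ g, h] \in <[c]>.
Proof.
have [u [v [w ->]]] := nform_surj g; have [s [t [r ->]]] := nform_surj h.
apply/cycleP; exists (v * s - u * t)%R; apply: (mulgI (nform s t r * nform u v w)).
by rewrite -nform_swap -commgC.
Qed.

Lemma commute_c (g : gT) : commute c g.
Proof.
have [u [v [w ->]]] := nform_surj g.
by apply: commuteM; [apply: commuteM|]; apply: commuteX => //; apply: commute_sym.
Qed.

Lemma expg_c_eq (u v : 'Z_m) : c ^+ u = c ^+ v -> u = v %[mod p].
Proof. by move/eqP; rewrite eq_expg_mod_order oc => /eqP. Qed.

(** By [nform_swap], commuting with [a] and with [b] makes [p] divide the exponents of [b] and of
    [a] in [d]; the [p]-th powers of both lie in [<[c]>]. *)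
Lemma central_cycle (d : gT) : (forall g, commute d g) -> d \in <[c]>.
Proof.
move=> cd; have [s [t [r def_d]]] := nform_surj d.
have modX (x : gT) (n : nat) : x ^+ p \in <[c]> -> c ^+ n = 1 -> x ^+ n \in <[c]>.
  move=> xp /eqP; rewrite -order_dvdn oc => /dvdnP[q ->].
  by rewrite mulnC expgM groupX.
have cs : c ^+ s = 1.
  apply: (mulgI (d * a)).
  rewrite mulg1 [in RHS](cd a) def_d nform_a [in RHS]nform_swap.
  by rewrite mul1r mul0r subr0.
have ct : c ^+ t = 1.
  apply: (mulgI (b * d)).
  rewrite mulg1 -[in RHS](cd b) def_d nform_b [in RHS]nform_swap.
  by rewrite mulr1 mulr0 subr0.
by rewrite def_d; do !apply: groupM; rewrite ?mem_cycle //; apply: modX.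
Qed.

(** * Rota-Baxter operators in normal form *)

Section RotaBaxter.

Variable B : gT -> gT.
Hypothesis rbB : rota_baxter B.

Lemma rota_baxter1 : B 1 = 1.
Proof. by apply: (mulgI (B 1)); rewrite rbB mul1g !mulg1 mulgV. Qed.

Lemma rota_baxter_mulc (g : gT) (n : nat) : B (g * c ^+ n) = B g * B c ^+ n.
Proof.
elim: n => [|n IHn]; first by rewrite !mulg1.
rewrite expgSr mulgA [in RHS]expgSr mulgA -IHn rbB; congr B.
by rewrite -(mulgA _ (B _) c) -(commute_c (B _)) !mulgA mulgK.
Qed.

(* For [d := B c] and [d h d^-1 = h c^n], the identity applied to [c] and [h]
   shows that [d^n] is a commutator.  If [p] does not divide [n], then [c] is a
   power of [c^n], so [d] is a power of [d^n]. *)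
Lemma rota_baxter_c : B c \in <[c]>.
Proof.
apply: central_cycle => h; set d := B c.
have /cycleP[n def_n] := commg_cycle h d^-1.
have dhd : d * h * d^-1 = h * c ^+ n.
  by rewrite -def_n commgEl mulKVg /conjg invgK mulgA.
have dn : d ^+ n \in <[c]>.
  suff -> : d ^+ n = [~ d, B h] by apply: commg_cycle.
  apply: (mulgI (B h * d)); rewrite -commgC -mulgA -expgS -rota_baxter_mulc.
  rewrite rbB -/d; congr B.
  by rewrite -!mulgA (mulgA d) dhd expgS mulgA -(commute_c h) -mulgA.
have [p_n | n_p] := boolP (p %| n).
  have cn : c ^+ n = 1 by apply/eqP; rewrite -order_dvdn oc.
  by apply: (mulIg d^-1); rewrite dhd cn mulg1 mulgK.
have gen_cn : generator <[c]> (c ^+ n).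
  by rewrite generator_coprime oc prime_coprime.
have /cycleP[j def_c] : c \in <[c ^+ n]> by rewrite -(eqP gen_cn) cycle_id.
have def_d : d = (d ^+ n) ^+ j.
  have := rota_baxter_mulc 1 (n * j).
  by rewrite rota_baxter1 !mul1g !expgM -def_c.
have [i ->] : exists i, d = c ^+ i by apply/cycleP; rewrite def_d groupX.
exact/commute_sym/commuteX/commute_sym/commute_c.
Qed.

Variables k la lb ma mb xa xb : 'Z_m.
Hypotheses (Bc : B c = c ^+ k).
Hypotheses (Ba : B a = nform ma la xa) (Bb : B b = nform mb lb xb).

(** Conjugating [nform s t r] by [B g] multiplies it by a power of [c], which [rota_baxter_mulc]
    extracts from [B]. *)
Lemma rota_baxter_mul (g : gT) (u v w s t r : 'Z_m) :
  B g = nform u v w ->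
  B g * B (nform s t r) = B (g * nform s t r) * c ^+ (k * (v * s - u * t))%R.
Proof.
move=> Bg; rewrite rbB expg_ZpM // expgM -Bc -rota_baxter_mulc; congr B.
have swapB : B g * nform s t r = nform s t r * B g * c ^+ (v * s - u * t)%R.
  by rewrite Bg nform_swap.
rewrite -(mulgA g) swapB -(mulgA _ (B g)).
by rewrite (commuteX _ (commute_sym (commute_c (B g)))) !mulgA mulgK.
Qed.

Lemma natr_bin2S (n : nat) :
  (('C(n.+1, 2))%:R = 'C(n, 2)%:R + n%:R :> 'Z_m)%R.
Proof. by rewrite binS bin1 natrD. Qed.

(** Splitting off one [b] on the left adds [lb * mb * n] from [nform_mul] and [- k * lb * n] from
    [rota_baxter_mul]; the sum of these increments is the binomial term. *)
Lemma rota_baxter_expb (n : nat) :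
  B (b ^+ n) = nform (mb * n%:R)%R (lb * n%:R)%R
                     (xb * n%:R + lb * (mb - k) * 'C(n, 2)%:R)%R.
Proof.
elim: n => [|n IHn].
  by rewrite rota_baxter1 !mulr0 addr0 -nform_c.
have def_bn : b ^+ n = nform n%:R%R 0%R 0%R.
  by rewrite -[0%R]/(0%:R)%R nform_nat !mulg1.
have := rota_baxter_mul n%:R%R 0%R 0%R Bb.
rewrite -def_bn -expgS IHn Bb nform_mul => def_B.
apply: (mulIg (c ^+ (k * (lb * n%:R - mb * 0))%R)); rewrite -def_B nform_mulc.
by rewrite natr_bin2S -natr1; congr nform; ring.
Qed.

Lemma rota_baxter_expa (n : nat) :
  B (a ^+ n) = nform (ma * n%:R)%R (la * n%:R)%R
                     (xa * n%:R + ma * (la + k) * 'C(n, 2)%:R)%R.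
Proof.
elim: n => [|n IHn].
  by rewrite rota_baxter1 !mulr0 addr0 -nform_c.
have def_an : a ^+ n = nform 0%R n%:R%R 0%R.
  by rewrite -[0%R]/(0%:R)%R nform_nat mul1g !mulg1.
have := rota_baxter_mul 0%R n%:R%R 0%R Ba.
rewrite -def_an -expgS IHn Ba nform_mul => def_B.
apply: (mulIg (c ^+ (k * (la * 0 - ma * n%:R))%R)); rewrite -def_B nform_mulc.
by rewrite natr_bin2S -natr1; congr nform; ring.
Qed.

Lemma rota_baxter_form : has_B_form p a b c B la lb ma mb xa xb k.
Proof.
move=> t s r _ _ _.
rewrite rota_baxter_mulc Bc.
have def_at : a ^+ t = nform 0%R t%:R%R 0%R.
  by rewrite -[0%R]/(0%:R)%R nform_nat mul1g !mulg1.
(* In the coefficient of [t * s], [lb * ma] comes from multiplying the normal forms and [k * mb]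
   from the Rota-Baxter correction. *)
have := rota_baxter_mul 0%R t%:R%R 0%R (rota_baxter_expb s).
rewrite -def_at rota_baxter_expa rota_baxter_expb nform_mul => def_B.
rewrite -expgM -(expg_Zp_nat m_gt1 cm (k * r)) natrM natr_Zp.
apply: (mulIg (c ^+ (k * (lb * s%:R * 0 - mb * s%:R * t%:R))%R)).
rewrite -mulgA (commuteX2 _ _ (erefl (c * c))) mulgA -def_B.
rewrite -/(nform _ _ _) !nform_mulc /B_alpha /B_beta /B_gamma.
rewrite !subn1 !divn2 -!bin2 natrM; congr nform; ring.
Qed.

(** Expand [B a * B b] in two ways: through [B (a * b) = B (b * a) * c ^+ k], and by swapping the
    factors. Equality of powers of [c] expresses congruence modulo [p] for either value of [m]. *)
Lemma rota_baxter_param :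
  c ^+ (la * mb - k * la)%R = c ^+ (lb * ma + k * mb + k)%R.
Proof.
have := rota_baxter_mul 0%R 1%R 0%R Bb; rewrite -nform_a => BbBa.
have := rota_baxter_mul 1%R 0%R 0%R Ba; rewrite -nform_b => BaBb.
have Bab : B (a * b) = B (b * a) * c ^+ k.
  by rewrite commgC comm_ab -[c]expg1 rota_baxter_mulc Bc expg1.
have Bba : B (b * a) = B b * B a * c ^+ (k * mb)%R.
  rewrite BbBa -mulgA -expg_ZpD //.
  by rewrite [X in c ^+ (nat_of_ord X)](_ : _ = 0%R) ?mulg1 //; ring.
move: BaBb; rewrite Bab Bba {1}Ba {1}Bb nform_swap -Ba -Bb -!mulgA.
move/mulgI/mulgI; rewrite -!expg_ZpD // => eq_c.
have := congr1 (mulg (c ^+ (lb * ma - k * la)%R)) eq_c.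
rewrite -!expg_ZpD // => eq_c'.
transitivity (c ^+ (lb * ma - k * la + (la * mb - ma * lb))%R).
  by congr (c ^+ (nat_of_ord _)); ring.
by rewrite eq_c'; congr (c ^+ (nat_of_ord _)); ring.
Qed.

End RotaBaxter.

End CentralExtension.

(** * The order of [c] in the presented groups *)

Lemma homg_nonabelian (rT gT : finGroupType) (H : {group rT}) (G : {group gT}) :
  H \homg G -> ~~ abelian H -> ~~ abelian G.
Proof. by case/homgP=> f <-; apply: contra => /morphim_abelian. Qed.

Lemma gen3_nonabelian_neq1 (gT : finGroupType) (a b c : gT) :
  <<[set a; b; c]>> = [set: gT] -> [~ a, b] = c -> ~~ abelian [set: gT] -> c != 1.
Proof.
move=> genG Dc; apply: contra => /eqP c1.
have cab : commute a b by apply/commgP; rewrite Dc c1.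
rewrite -genG abelian_gen c1; apply/centsP=> x; rewrite !inE -orbA => xabc y.
rewrite !inE -orbA; case/or3P: xabc => /eqP-> /or3P[]/eqP-> //;
  do ?[exact: commute1 | exact: commute_sym (commute1 _) | exact: commute_sym].
Qed.

Section ExtraspecialGroups.

Variables (p : nat) (gT : finGroupType) (a b c : gT).
Hypotheses (p_prime : prime p) (p_odd : odd p).

(* The extraspecial group [p^{1+2}] is a nonabelian quotient. *)
Lemma H3_order_c : is_H3 p a b c -> #[c] = p.
Proof.
case=> isoG genG [Dc _ _] [_ _ cp].
apply: nt_prime_order => //; apply: gen3_nonabelian_neq1 genG Dc _.
have esH := pX1p2_extraspecial p_prime.
apply: homg_nonabelian (extraspecial_nonabelian esH).
rewrite isoG; have := isoGrp_hom (Grp_pX1p2 p_prime).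
case/existsP=> -[x y] /= /eqP[defG xp yp].
move=> /eqP/commgP/commute_sym cxz /eqP/commgP/commute_sym cyz.
have Dz : [~ x, y] ^+ p = 1.
  by rewrite -commXg ?xp ?comm1g.
apply/existsP; exists (x, y, [~ x, y]) => /=.
rewrite !xpair_eqE xp yp Dz (introT commgP cxz) (introT commgP cyz).
rewrite !eqxx !andbT.
by rewrite eqEsubset subsetT -defG joing_subl.
Qed.

(* The modular group of order [p ^ 3] is a nonabelian quotient, under
   [(a, b) |-> (x, x * y)]; here [(x * y) ^+ p = x ^+ p] because [p] is odd. *)
Lemma E3_order_c : is_E3 p a b c -> #[c] = p.
Proof.
case=> isoG genG [Dc _ _] [_ _ cp].
apply: nt_prime_order => //; apply: gen3_nonabelian_neq1 genG Dc _.
have isoM := Grp_modular_group p_prime (isT : 2 < 3).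
apply: (@homg_nonabelian _ _ ('Mod_(p ^ 3))%G).
  rewrite isoG.
  have := isoGrp_hom isoM.
  case/existsP=> -[x y] /= /eqP[defG xq yp]; rewrite expn1 => xy.
  have Dz : [~ x, x * y] = x ^+ p.
    by rewrite commgEl conjgM /conjg mulKg -/(conjg x y) xy expgS mulKg.
  have Dxy : [~ x, y] = x ^+ p by rewrite commgEl xy expgS mulKg.
  have zp : (x ^+ p) ^+ p = 1 by rewrite -expgM.
  have cxz : commute x (x ^+ p) by apply: commuteX.
  have cyz : commute y (x ^+ p).
    apply/commute_sym/commgP/conjg_fixP.
    by rewrite conjXg xy -expgM mulSn expgD mulnn xq mulg1.
  have xyp : (x * y) ^+ p = x ^+ p.
    rewrite expMg_Rmul -invg_comm Dxy.
    - have /dvdnP[q ->] : p %| 'C(p, 2).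
        by apply: prime_dvd_bin => //; rewrite odd_prime_gt2.
      by rewrite yp expgVn mulnC expgM zp expg1n invg1 !mulg1.
    - by apply: commuteV.
    - by apply: commuteV.
  apply/existsP; exists (x, x * y, x ^+ p) => /=.
  rewrite !xpair_eqE Dz xyp zp !eqxx /=.
  have cxyz : commute (x * y) (x ^+ p).
    by apply/commute_sym/commuteM; apply: commute_sym.
  rewrite (introT commgP cxz) (introT commgP cxyz) !andbT.
  rewrite eqEsubset subsetT -defG (subset_trans _ (joing_subl _ _)) //.
  have sx : x \in <[x]> <*> <[x * y]> by rewrite -cycle_subG joing_subl.
  rewrite join_subG !cycle_subG sx -(groupMl _ sx).
  by rewrite -cycle_subG joing_subr.
have n_gt2 : 2 < 3 by [].
have [xy genM xyM] := generators_modular_group p_prime n_gt2 (isog_refl _).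
case: xy genM xyM => x y genM xyM.
by case: (modular_group_structure p_prime n_gt2 genM (isog_refl _) xyM) => -[].
Qed.

End ExtraspecialGroups.

Theorem proposition5 (p : nat) (gT : finGroupType) (a b c : gT) (B : gT -> gT)
    (p_prime : prime p) (p_odd : odd p) (rbB : rota_baxter B) :
  (is_H3 p a b c ->
     exists la lb ma mb xa xb k : 'Z_p,
       has_B_form p a b c B la lb ma mb xa xb k /\
       (la * mb - k * la = lb * ma + k * mb + k)%R) /\
  (is_E3 p a b c ->
     exists la lb ma mb xa xb k : 'Z_(p ^ 2),
       [/\ has_B_form p a b c B la lb ma mb xa xb k,
           eq_modp k (la + ma)%R,
           eq_modp k (lb + mb)%R &
           eq_modp k 0%R \/ eq_modp k (- 1)%R]).
Proof.
have p_gt1 := prime_gt1 p_prime.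
split=> [H3 | E3].
  have oc := H3_order_c p_prime H3.
  have [_ genG [Dc /eqP/commgP cac /eqP/commgP cbc] [ap bp cp]] := H3.
  have [ma [la [xa Ba]]] := nform_surj p_gt1 genG Dc cac cbc ap bp cp (B a).
  have [mb [lb [xb Bb]]] := nform_surj p_gt1 genG Dc cac cbc ap bp cp (B b).
  have /cycleP[n Bc] : B c \in <[c]>.
    apply: (rota_baxter_c p_prime p_gt1 genG Dc cac cbc ap bp cp) => //.
      by rewrite ap.
    by rewrite bp.
  rewrite -(expg_Zp_nat p_gt1 cp) in Bc.
  exists la, lb, ma, mb, xa, xb, (n%:R)%R; split.
    exact (rota_baxter_form p_gt1 genG Dc cac cbc ap bp cp rbB Bc Ba Bb).
  have /(expg_c_eq oc) :=
    rota_baxter_param p_gt1 genG Dc cac cbc ap bp cp rbB Bc Ba Bb.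
  (* Representatives are below [p], so the congruence is an equality in ['Z_p]. *)
  have Zp_lt (u : 'Z_p) : u < p by rewrite -{2}(Zp_cast p_gt1).
  by rewrite !modn_small // => /val_inj.
have oc := E3_order_c p_prime p_odd E3.
have [_ genG [Dc /eqP/commgP cac /eqP/commgP cbc] [ap bp cp]] := E3.
have q_gt1 : 1 < p ^ 2 by rewrite (ltn_exp2l 0).
have cq : c ^+ (p ^ 2) = 1 by rewrite expgM cp expg1n.
have aq : a ^+ (p ^ 2) = 1 by rewrite expgM ap cp.
have bq : b ^+ (p ^ 2) = 1 by rewrite expgM bp cp.
have [ma [la [xa Ba]]] := nform_surj q_gt1 genG Dc cac cbc aq bq cq (B a).
have [mb [lb [xb Bb]]] := nform_surj q_gt1 genG Dc cac cbc aq bq cq (B b).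
have /cycleP[n Bc] : B c \in <[c]>.
  apply: (rota_baxter_c p_prime q_gt1 genG Dc cac cbc aq bq cq) => //.
    by rewrite ap cycle_id.
  by rewrite bp cycle_id.
rewrite -(expg_Zp_nat q_gt1 cq) in Bc; set k : 'Z_(p ^ 2) := (n%:R)%R in Bc.
(* Here [c] is itself [a ^+ p], so [B c] is also given by the formula for powers of [a]. *)
have ka : c ^+ k = c ^+ (la + ma)%R.
  rewrite -Bc -{1}ap (rota_baxter_expa q_gt1 genG Dc cac cbc aq bq cq rbB Bc Ba).
  by rewrite nform_mulp // addrC.
have kb : c ^+ k = c ^+ (lb + mb)%R.
  rewrite -Bc -{1}bp (rota_baxter_expb q_gt1 genG Dc cac cbc aq bq cq rbB Bc Bb).
  by rewrite nform_mulp // addrC.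
exists la, lb, ma, mb, xa, xb, k; split.
- exact (rota_baxter_form q_gt1 genG Dc cac cbc aq bq cq rbB Bc Ba Bb).
- exact (expg_c_eq oc ka).
- exact (expg_c_eq oc kb).
(* Divisibility of [u] by [p] is expressed as [c ^+ u = 1], so that the congruences can be combined
   by [ring] in ['Z_(p ^ 2)]. *)
have ann_mul (x u : 'Z_(p ^ 2)) : c ^+ u = 1 -> c ^+ (x * u)%R = 1.
  by move=> cu; rewrite expg_ZpM // mulnC expgM cu expg1n.
have ann_sub (u v : 'Z_(p ^ 2)) : c ^+ u = c ^+ v -> c ^+ (u - v)%R = 1.
  by move=> cuv; apply: (mulIg (c ^+ v)); rewrite -expg_ZpD // subrK mul1g.
have := rota_baxter_param q_gt1 genG Dc cac cbc aq bq cq rbB Bc Ba Bb.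
move/esym/ann_sub => ann_param.
(* The multipliers [lb] and [k - la] make all other terms cancel: the sum with the exponent of
   [ann_param] is exactly [k * (k + 1)]. *)
have /(ann_mul lb) ann_a := ann_sub _ _ ka.
have /(ann_mul (k - la)%R) ann_b := ann_sub _ _ kb.
have : c ^+ (k * (k + 1))%R = 1.
  have := congr2 mulg (congr2 mulg ann_param ann_a) ann_b.
  rewrite -!expg_ZpD // !mulg1 => <-.
  by congr (c ^+ (nat_of_ord _)); ring.
rewrite expg_ZpM // => /eqP; rewrite -order_dvdn oc Euclid_dvdM //.
case/orP=> [k0 | k1]; [left | right].
  by rewrite /eq_modp mod0n; apply/eqP.
apply: (expg_c_eq oc); apply: (mulIg (c ^+ (1 : 'Z_(p ^ 2))%R)).
rewrite -!expg_ZpD // addNr; apply/eqP.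
by rewrite -order_dvdn oc.
Qed.
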